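(* Let $A$ be a $2\times2$ Hermitian matrix of Laurent polynomials with compatible symmetry whose symmetry type is $\mathrm{S}A(z)=\begin{bmatrix}1&\alpha(z)\\ \alpha^\star(z)&1\end{bmatrix}$, where $\alpha(z):=\mathrm{S}A_{1,2}(z)$. Suppose $\det(A(z))=C$ for all $z\in\mathbb T$, for some negative constant $C$. Then there exists a $2\times2$ matrix $U$ of Laurent polynomials with compatible symmetry such that $A(z)=U(z)\,\mathrm{diag}(1,-1)\,U^\star(z)$ and $$\frac{\mathrm{S}U_{1,1}(z)}{\mathrm{S}U_{2,1}(z)}=\frac{\mathrm{S}U_{1,2}(z)}{\mathrm{S}U_{2,2}(z)}=\alpha(z).$$
   Context: Laurent polynomials $u(z)=\sum_ku(k)z^k$ with finitely many nonzero complex coefficients; $\mathbb T:=\{z\in\mathbb C:|z|=1\}$. For a matrix $P(z)=\sum_kP(k)z^k$, $P^\star(z):=\sum_k\overline{P(k)}^Tz^{-k}$; Hermitian means $P^\star=P$. $u$ has symmetry of type $\epsilon z^c$ ($\epsilon\in\{\pm1\},c\in\mathbb Z$) if $u(z)=\epsilon z^cu(z^{-1})$; for nonzero $u$, $\mathrm{S}u(z):=u(z)/u(z^{-1})$; zero has every type; for a type $\beta=\epsilon z^c$, $\beta^\star:=\epsilon z^{-c}$. For a matrix $P$ whose entries have symmetry, $\mathrm{S}P$ is taken entrywise. An $r\times s$ matrix $P$ has compatible symmetry if there exist types $\tau_1,\dots,\tau_r,\rho_1,\dots,\rho_s$, each of the form $\pm z^m$ ($m\in\mathbb Z$), such that each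 entry $P_{j,k}$ has symmetry of type $\tau_j^{-1}\rho_k$. *)

(* Defs.v *)
From HB Require Import structures.
From mathcomp Require Import all_boot all_order all_algebra.
From mathcomp Require Import reals.
From mathcomp Require Import complex.
Set Implicit Arguments. Unset Strict Implicit. Unset Printing Implicit Defensive.
Import Order.TTheory GRing.Theory Num.Theory.
Local Open Scope ring_scope.

Section Laurent.
Variable R : realType.
Local Notation C := R[i].

(* A Laurent polynomial u(z) = sum_k u(k) z^k with finitely many nonzero
   coefficients; lsupp bounds the support: u(k) = 0 whenever |k| > lsupp. *)
Record lpoly := LPoly {
  lcoef : int -> C;
  lsupp : nat;
  lsuppP : forall k : int, (lsupp < `|k|)%N -> lcoef k = 0 }.

Definition leval (u : lpoly) (z : C) : C :=
  \sum_(i < (lsupp u).*2.+1)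
     lcoef u (i%:Z - (lsupp u)%:Z) * z ^ (i%:Z - (lsupp u)%:Z).

Lemma lstar_suppP (u : lpoly) :
  forall k : int, (lsupp u < `|k|)%N -> conjc (lcoef u (- k)) = 0.
Proof.
move=> k hk; rewrite (lsuppP (k:=-k)); first by rewrite /conjc /= oppr0.
by rewrite abszN.
Qed.

Definition lstar (u : lpoly) : lpoly :=
  @LPoly (fun k => conjc (lcoef u (- k))) (lsupp u) (@lstar_suppP u).

(* symmetry types eps z^c, encoded as (b, c) with eps = (-1)^b *)
Definition symtype := (bool * int)%type.
Definition tmul (a b : symtype) : symtype := (a.1 (+) b.1, a.2 + b.2).
Definition tinv (a : symtype) : symtype := (a.1, - a.2).
Definition tstar (a : symtype) : symtype := (a.1, - a.2).
Definition tone1 : symtype := (false, 0).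

(* u has symmetry of type eps z^c : u(z) = eps z^c u(z^{-1}),
   i.e. coefficientwise u(m) = eps u(c - m).  (0 has every type.) *)
Definition lp_has_sym (u : lpoly) (t : symtype) : Prop :=
  forall m : int, lcoef u m = (-1) ^+ t.1 * lcoef u (t.2 - m).

Definition compat_sym_with r s (P : 'M[lpoly]_(r, s))
    (tau : 'I_r -> symtype) (rho : 'I_s -> symtype) : Prop :=
  forall j k, lp_has_sym (P j k) (tmul (tinv (tau j)) (rho k)).

Definition compat_sym r s (P : 'M[lpoly]_(r, s)) : Prop :=
  exists tau rho, compat_sym_with P tau rho.

Definition mxstar r s (P : 'M[lpoly]_(r, s)) : 'M[lpoly]_(s, r) :=
  \matrix_(i, j) lstar (P j i).

Definition lp_hermitian n (P : 'M[lpoly]_n) : Prop :=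
  forall i j, lcoef (mxstar P i j) =1 lcoef (P i j).

Definition mxeval r s (P : 'M[lpoly]_(r, s)) (z : C) : 'M[C]_(r, s) :=
  \matrix_(i, j) leval (P i j) z.

Definition J2 : 'M[C]_2 :=
  \matrix_(i, j) (if i == j then (if val i == 0%N then 1 else -1) else 0).

End Laurent.

(* Main.v *)
Require Import Defs.
From HB Require Import structures.
From mathcomp Require Import all_boot all_order all_algebra.
From mathcomp Require Import reals complex ring zify.
Import Order.TTheory GRing.Theory Num.Theory.
Local Open Scope ring_scope.
Set Implicit Arguments. Unset Strict Implicit. Unset Printing Implicit Defensive.

(** Put [x = z + 1/z].  A Laurent polynomial of a fixed symmetry type is
    [g(z) p(x)] for one generator [g] among [z^k], [z^k (z - 1/z)],
    [z^k (1 + z)], [z^k (1 - z)], and [g g^* = N(x)] with [N] among [1],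
    [4 - x^2], [2 + x], [2 - x].  Hence [A] becomes a Hermitian form over [C[x]],
    evaluated on the vectors [(p(x), g(z) r(x))], of determinant [C N].

    Euclidean reduction gives a basis in which the off-diagonal entry has smaller
    degree than the two diagonal ones, whose degrees then add up to [deg N <= 2].
    So some vector [v] of the right symmetry has [v A v^* = l] constant and
    nonzero, except when [N = 4 - x^2] and both diagonal entries are linear.  In
    that case a constant combination of the two basis vectors has value
    [l (x + 2)] and first entry vanishing at [x = -2], and dividing it by [1 + z]
    gives [v].  If the reduction stops at an isotropic vector instead, then [N = 1]
    and the off-diagonal entry is constant, so the value [1] is represented.

    With [y = v A] and [n = (- v2, v1)], finally, [l A = y^* y + C n^T (n^T)^*],
    which is the factorization up to scaling. *)

(** * Hermitian forms over polynomials *)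

Section HermitianForms.
Variable F : numClosedFieldType.
Implicit Types p q : {poly F}.

(** Conjugating coefficients is the star operation read in the variable [x = z + 1/z], since [x] is
    its own star. *)
Definition pconj p : {poly F} := map_poly (Num.conj_op : F -> F) p.

HB.instance Definition _ :=
  GRing.RMorphism.copy pconj (map_poly (Num.conj_op : F -> F)).

Lemma pconjK p : pconj (pconj p) = p.
Proof. by apply/polyP => i; rewrite !coef_map /= conjCK. Qed.

Lemma size_pconj p : size (pconj p) = size p.
Proof. exact: size_map_poly. Qed.

Lemma size_mul_pconj p : size (p * pconj p) = (size p + size p).-1.
Proof.
have [->|p0] := eqVneq p 0; first by rewrite mul0r size_poly0.
by rewrite size_mul ?size_pconj // -size_poly_gt0 size_pconj size_poly_gt0.
Qed.

Lemma pconjC (c : F) : pconj c%:P = (c^*)%:P.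
Proof. exact: map_polyC. Qed.

Lemma pconjX : pconj 'X = 'X.
Proof. exact: map_polyX. Qed.

Lemma lead_coef_pconj p : lead_coef (pconj p) = (lead_coef p)^*.
Proof. exact: lead_coef_map. Qed.

Lemma horner_pconj p (x : F) : (pconj p).[x] = (p.[x^*])^*.
Proof. by rewrite -{1}[x]conjCK horner_map. Qed.

Lemma size2_polyE p : (size p <= 2)%N -> p = (p`_1)%:P * 'X + (p`_0)%:P.
Proof.
move=> sp; apply/polyP => -[|[|i]]; rewrite coefD coefCM coefX coefC /=.
- by rewrite mulr0 add0r.
- by rewrite mulr1 addr0.
- by rewrite mulr0 addr0 nth_default // (leq_trans sp).
Qed.

(** Three polynomials encode the Gram matrix, whose lower left entry is [pconj h12]; the form is
    conjugate-linear in [v]. *)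
Definition hform (h11 h12 h22 : {poly F}) (u v : {poly F} * {poly F}) : {poly F} :=
  u.1 * pconj v.1 * h11 + u.1 * pconj v.2 * h12 +
  u.2 * pconj v.1 * pconj h12 + u.2 * pconj v.2 * h22.

Variables h11 h12 h22 : {poly F}.
Hypotheses (h11_real : pconj h11 = h11) (h22_real : pconj h22 = h22).
Local Notation B := (hform h11 h12 h22).
Local Notation D := (h11 * h22 - h12 * pconj h12).

Lemma hformC u v : pconj (B u v) = B v u.
Proof. by rewrite /hform !rmorphD !rmorphM /= !pconjK h11_real h22_real; ring. Qed.

(** With [e] and [f] as rows of a transition matrix, the Gram determinant is multiplied by the norm
    of its determinant. *)
Lemma hform_det e f :
  B e e * B f f - B e f * B f e =
  D * ((e.1 * f.2 - e.2 * f.1) * pconj (e.1 * f.2 - e.2 * f.1)).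
Proof. by rewrite /hform !rmorphB !rmorphM /=; ring. Qed.

Definition comb (s : {poly F}) e (t : {poly F}) f : {poly F} * {poly F} :=
  (s * e.1 + t * f.1, s * e.2 + t * f.2).

Lemma hform_comb s e t f :
  B (comb s e t f) (comb s e t f) =
  s * pconj s * B e e + s * pconj t * B e f + t * pconj s * B f e +
  t * pconj t * B f f.
Proof. by rewrite /hform /= !rmorphD !rmorphM /=; ring. Qed.

(** Gauss reduction with degree as measure: replace [B e f] by its remainder modulo [B e e], then
    exchange the vectors if the second value became the smaller one. Only an isotropic [e] blocks
    the division. *)
Lemma hform_reduction : exists e f : {poly F} * {poly F},
  (e.1 * f.2 - e.2 * f.1) * pconj (e.1 * f.2 - e.2 * f.1) = 1 /\
  (B e e = 0 \/ (size (B e f) < size (B e e) <= size (B f f))%N).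
Proof.
suff H n : forall e f : {poly F} * {poly F},
    (e.1 * f.2 - e.2 * f.1) * pconj (e.1 * f.2 - e.2 * f.1) = 1 ->
    (size (B e e) <= n)%N ->
    exists e f : {poly F} * {poly F},
    (e.1 * f.2 - e.2 * f.1) * pconj (e.1 * f.2 - e.2 * f.1) = 1 /\
    (B e e = 0 \/ (size (B e f) < size (B e e) <= size (B f f))%N).
  apply: (H _ (1, 0) (0, 1) _ (leqnn _)) => /=.
  by rewrite !mulr0 mulr1 subr0 rmorph1 mulr1.
elim: n => [|n IHn] e f def.
  by rewrite leqn0 size_poly_eq0 => /eqP h; exists e, f; auto.
move=> le; have [h0|h0] := eqVneq (B e e) 0; first by exists e, f; auto.
pose q := B e f %/ B e e.
(* The quotient is conjugated because the form is conjugate-linear in its second argument; [B e f']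
   is then the remainder. *)
pose f' := comb (- pconj q) e 1 f.
have def' : (e.1 * f'.2 - e.2 * f'.1) = (e.1 * f.2 - e.2 * f.1).
  by rewrite /f' /=; ring.
have Bef' : B e f' = B e f %% B e e.
  have := divp_eq (B e f) (B e e); rewrite -/q => E.
  have -> : B e f' = B e f - q * B e e.
    by rewrite /f' /hform /= !rmorphD !rmorphM !rmorphN /= pconjK rmorph1; ring.
  by rewrite {1}E addrC addKr.
have lt : (size (B e f') < size (B e e))%N by rewrite Bef' ltn_modp.
case: (leqP (size (B e e)) (size (B f' f'))) => hs.
  by exists e, f'; rewrite def' lt hs; auto.
(* Exchanging the vectors only changes the sign of the transition determinant, so its norm stays
   1. *)
apply: (IHn f' e); last by rewrite -ltnS (leq_trans hs).
have -> : f'.1 * e.2 - f'.2 * e.1 = - (e.1 * f'.2 - e.2 * f'.1) by ring.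
by rewrite rmorphN mulrNN def'.
Qed.


(** The product [b * pconj b] has smaller degree than [a * d], so nothing cancels at the top. *)
Lemma size_reduced_det (a d b : {poly F}) :
  (size b < size a <= size d)%N ->
  size (a * d - b * pconj b) = (size a + size d).-1 /\
  lead_coef (a * d - b * pconj b) = lead_coef a * lead_coef d.
Proof.
case/andP=> ba ad.
have a0 : a != 0 by rewrite -size_poly_gt0; lia.
have d0 : d != 0 by rewrite -size_poly_gt0; lia.
have sad : size (a * d) = (size a + size d).-1 by rewrite size_mul.
have sb : (size (- (b * pconj b))%R < size (a * d)%R)%N.
  by rewrite size_polyN sad; rewrite size_mul_pconj; lia.
by rewrite size_polyDl // lead_coefDl // lead_coefM sad.
Qed.

Lemma self_conj_const (p : {poly F}) : pconj p = p -> size p = 1%N ->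
  exists l : F, [/\ l != 0, l^* = l & p = l%:P].
Proof.
move=> hp /eqP/size_poly1P[c c0 E]; exists c; split=> //.
by move: hp; rewrite E pconjC => /polyC_inj.
Qed.

(** When [D] has degree at most 1, the reduced diagonal degrees add up to at most 1, so the smaller
    one is 0. *)
Lemma hform_const_value : D != 0 -> (size D <= 2)%N ->
  exists v (l : F), [/\ l != 0, l^* = l & B v v = l%:P].
Proof.
move=> D0 sD; have [e [f [def red]]] := hform_reduction.
have detE := hform_det e f; rewrite def mulr1 -[B f e]hformC in detE.
case: red => [h0|red]; last first.
  have [sz _] := size_reduced_det red; rewrite detE in sz.
  have [|l hl] := self_conj_const (hformC e e); last by exists e, l.
  have : (0 < size D)%N by rewrite size_poly_gt0.
  by lia.
(* For isotropic [e] the determinant is minus the norm of [B e f]; its degree is even and at most 1,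
   so [B e f] is a constant [c]. *)
rewrite h0 mul0r sub0r in detE.
set m := B e f in detE.
have m0 : m != 0 by apply: contraNneq D0 => m0; rewrite -detE m0 mul0r oppr0.
have [c c0 mE] : exists2 c : F, c != 0 & m = c%:P.
  apply/size_poly1P; move: sD; rewrite -detE size_polyN size_mul_pconj.
  by have : (0 < size m)%N; [rewrite size_poly_gt0 | lia].
(* The value at [s e + f] is [s c] plus its conjugate plus [B f f]; this [s] makes [s c] equal to
   the self-conjugate [(1 - B f f) / 2], so the value is 1. *)
pose s := (2 * c)^-1%:P * (1 - B f f).
exists (comb s e 1 f), 1; split; rewrite ?oner_neq0 ?conjC1 //.
rewrite hform_comb // h0 -[B f e]hformC -/m mE rmorph1 !mulr1 mul1r mulr0 add0r.
have sc : s * c%:P = 2^-1%:P * (1 - B f f).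
  rewrite /s mulrAC -polyCM invfM -mulrA mulVf // mulr1 //.
rewrite sc -[_ * pconj c%:P]rmorphM sc rmorphM rmorphB rmorph1 /= hformC pconjC.
have half : (2^-1)%:P + (2^-1)%:P = 1 :> {poly F}.
  by rewrite -polyCD; congr (_%:P); field.
have -> : (2^-1)^* = 2^-1 :> F by rewrite fmorphV rmorph_nat.
by rewrite mul1r -mulrDl [X in X * _]half mul1r subrK.
Qed.

Lemma root_hform v (x : F) : x^* = x -> root h12 x -> root h22 x ->
  root v.1 x -> root (B v v) x.
Proof.
move=> xr r12 r22 rv; rewrite /root /hform !hornerD !hornerM !horner_pconj xr.
by rewrite (rootP r12) (rootP r22) (rootP rv) conjC0 !(mul0r, mulr0, addr0).
Qed.

(** Here the reduced diagonal degrees are 0 and 2, or 1 and 1. In the second case the positive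
    leading coefficient of [D] gives both diagonal entries leading coefficients of the same sign, so
    a nonzero constant combination keeps its linear term and can be chosen to vanish at -2. *)
Lemma hform_linear_value :
  size D = 3 -> 0 < lead_coef D -> root h12 (- 2) -> root h22 (- 2) ->
  exists v (l : F), [/\ l != 0, l^* = l &
    B v v = l%:P \/ B v v = l%:P * ('X + 2%:P) /\ root v.1 (- 2)].
Proof.
move=> sD lD r12 r22; have [e [f [def red]]] := hform_reduction.
have detE := hform_det e f; rewrite def mulr1 -[B f e]hformC in detE.
case: red => [h0|red].
  (* An isotropic [e] would make the leading coefficient of [D] minus a squared modulus, against
     [lD]. *)
  move: lD; rewrite -detE h0 mul0r sub0r lead_coefN lead_coefM lead_coef_pconj.
  by rewrite oppr_gt0 le_gtF // mul_conjC_ge0.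
have [sz lc] := size_reduced_det red; rewrite detE sD in sz.
rewrite detE in lc; rewrite lc in lD.
have [s1|s1] := eqVneq (size (B e e)) 1%N.
  have [l [l0 lr E]] := self_conj_const (hformC e e) s1.
  by exists e, l; split=> //; left.
have [se sf] : size (B e e) = 2%N /\ size (B f f) = 2%N.
  by have := sz; have := red; case/andP; lia.
have sef : (size (B e f) <= 1)%N by move: red; rewrite se; lia.
(* These constants cancel the first entries of [e] and [f] against each other at -2. *)
pose s := (f.1).[-2]; pose t := - (e.1).[-2].
pose v := comb s%:P e t%:P f.
have v2 : root v.1 (- 2).
  by rewrite /root /v /comb !hornerE /s /t; apply/eqP; ring.
have rootB : root (B v v) (- 2).
  by apply: root_hform; rewrite // rmorphN rmorph_nat.
(* If both vanished, the transition determinant would vanish at -2, but its norm is 1. *)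
have st0 : (s != 0) || (t != 0).
  apply/negP => /negP; rewrite negb_or !negbK => /andP[/eqP s0 /eqP t0].
  have := congr1 (fun p => p.[-2]) def; rewrite hornerM hornerD hornerN !hornerM.
  have -> : (e.1).[-2] = 0 by apply: oppr_inj; rewrite -/t t0 oppr0.
  rewrite -/s s0 mul0r mulr0 subr0 mul0r hornerC => /eqP.
  by rewrite eq_sym oner_eq0.
have Bv := hform_comb s%:P e t%:P f; rewrite -/v in Bv.
have sfe : (size (B f e) <= 1)%N by rewrite -hformC size_pconj.
have sv : (size (B v v) <= 2)%N.
  have szD (p q : {poly F}) :
      (size p <= 2)%N -> (size q <= 2)%N -> (size (p + q)%R <= 2)%N.
    by move=> hp hq; rewrite (leq_trans (size_polyD p q)) // geq_max hp.
  have szZ (c : F) (p : {poly F}) : (size p <= 2)%N -> (size (c%:P * p)%R <= 2)%N.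
    by move=> hp; rewrite mul_polyC (leq_trans (size_scale_leq c p)).
  rewrite Bv !pconjC -!polyCM.
  by do 3?apply: (szD); apply: (szZ);
    rewrite ?se ?sf ?(leq_trans sef) ?(leq_trans sfe).
(* The cross terms are constant and contribute nothing in degree 1. *)
have lv : (B v v)`_1 = `|s| ^+ 2 * lead_coef (B e e) + `|t| ^+ 2 * lead_coef (B f f).
  rewrite Bv !pconjC -!polyCM !coefD !coefCM !lead_coefE se sf /=.
  rewrite (nth_default _ sef) (nth_default _ sfe).
  by rewrite !mulr0 !addr0 !normCK.
have lr g : (lead_coef (B g g))^* = lead_coef (B g g).
  by rewrite -lead_coef_pconj hformC.
have l0 : (B v v)`_1 != 0.
  have re g : lead_coef (B g g) \is Num.real by apply/CrealP; rewrite lr.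
  rewrite lv; move: lD; set A := lead_coef _; set A' := lead_coef _ => lD.
  have A0 : A != 0 by apply: contraTneq lD => ->; rewrite mul0r ltxx.
  apply/negP => /eqP/(congr1 (fun x => A * x)); rewrite mulr0 => /eqP.
  (* Multiplying by the real number [A] turns the linear coefficient into a sum of nonnegative
     terms, since [A * A'] is the leading coefficient of [D]. *)
  have -> : A * (`|s| ^+ 2 * A + `|t| ^+ 2 * A') =
     `|s| ^+ 2 * A ^+ 2 + `|t| ^+ 2 * (A * A') by ring.
  have A2 : 0 < A ^+ 2 by rewrite real_exprn_even_gt0 ?re // A0 orbT.
  rewrite gt_eqF //.
  have sA : 0 <= `|s| ^+ 2 * A ^+ 2 by rewrite (mulr_ge0 (exprn_ge0 2 _)) // ltW.
  have tA : 0 <= `|t| ^+ 2 * (A * A') by rewrite (mulr_ge0 (exprn_ge0 2 _)) // ltW.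
  by case/orP: st0 => st0; [apply: ltr_pwDl | apply: ltr_wpDl] => //;
    apply: mulr_gt0; rewrite // exprn_gt0 // normr_gt0.
exists v, (B v v)`_1; split=> //.
  by rewrite -[in RHS]hformC coef_map.
right; split=> //.
move: rootB; rewrite /root => /eqP rB.
have E := size2_polyE sv.
have E0 : (B v v)`_0 = (B v v)`_1 * 2.
  move: rB; rewrite {1}E hornerD hornerM hornerX !hornerC => /eqP.
  by rewrite mulrN addrC subr_eq0 => /eqP.
by rewrite {1}E E0 polyCM mulrDr.
Qed.

End HermitianForms.

(** * Laurent polynomials as functions on the punctured plane *)

Lemma poly_inj_roots (F : idomainType) (x : nat -> F) (p : {poly F}) :
  injective x -> (forall n, root p (x n)) -> p = 0.
Proof.
move=> xI px; apply/eqP; apply/contraT => p0.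
suff: (size (mkseq x (size p)) < size p)%N by rewrite size_mkseq ltnn.
apply: max_poly_roots => //; last by rewrite map_inj_uniq // iota_uniq.
by apply/allP => _ /mapP[n _ ->].
Qed.

Section LaurentFunctions.
Variable R : realType.
Local Notation C := R[i].
Implicit Types (u v : lpoly R) (f g : C -> C) (t : symtype) (p q : {poly C}).

Definition srange (M : nat) : seq int :=
  [seq i%:Z - M%:Z | i : nat <- index_iota 0 M.*2.+1].

Lemma mem_srange M (k : int) : (k \in srange M) = (`|k| <= M)%N.
Proof.
apply/mapP/idP => [[j]|hk].
  by rewrite mem_index_iota => /andP[_ hj] ->; lia.
by exists (absz (k + M%:Z)); rewrite ?mem_index_iota; lia.
Qed.

Lemma srange_uniq M : uniq (srange M).
Proof. by rewrite map_inj_uniq ?iota_uniq // => i j; lia. Qed.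

(** The bound [lsupp] is not canonical; summing over any duplicate-free list that covers the support
    allows reindexing and common ranges. *)
Lemma leval_uniq u (s : seq int) (z : C) :
  uniq s -> (forall k, k \notin s -> lcoef u k = 0) ->
  leval u z = \sum_(k <- s) lcoef u k * z ^ k.
Proof.
move=> us hs.
have nz (r : seq int) : \sum_(k <- r) lcoef u k * z ^ k =
    \sum_(k <- [seq k <- r | lcoef u k != 0]) lcoef u k * z ^ k.
  rewrite big_filter [RHS]big_mkcond; apply: eq_bigr => k _.
  by case: eqP => //= ->; rewrite mul0r.
have -> : leval u z = \sum_(k <- srange (lsupp u)) lcoef u k * z ^ k.
  by rewrite /leval /srange big_map big_mkord.
rewrite nz [RHS]nz; apply: perm_big; apply: uniq_perm.
- by rewrite filter_uniq ?srange_uniq.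
- by rewrite filter_uniq.
move=> k; rewrite !mem_filter; case: eqVneq => //= uk; rewrite mem_srange.
have -> : k \in s by apply: contraNT uk => /hs ->.
by rewrite leqNgt; apply: contraNN uk => /lsuppP ->.
Qed.

Lemma leval_widen u M (z : C) : (lsupp u <= M)%N ->
  leval u z = \sum_(k <- srange M) lcoef u k * z ^ k.
Proof.
move=> hM; apply: leval_uniq; first exact: srange_uniq.
by move=> k; rewrite mem_srange -ltnNge => hk; rewrite lsuppP // (leq_ltn_trans hM).
Qed.

(** Multiplying the difference by [z ^ M] gives an ordinary polynomial, which vanishes at every
    positive integer. *)
Lemma leval_inj u v : (forall z : C, z != 0 -> leval u z = leval v z) ->
  lcoef u =1 lcoef v.
Proof.
move=> E k; set M := maxn (lsupp u) (lsupp v).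
case: (leqP `|k| M) => hk; last first.
  by move: hk; rewrite gtn_max => /andP[? ?]; rewrite !lsuppP.
pose w (i : nat) : C := lcoef u (i%:Z - M%:Z) - lcoef v (i%:Z - M%:Z).
pose p : {poly C} := \poly_(i < M.*2.+1) w i.
suff p0 : p = 0.
  have := congr1 (fun q : {poly C} => q`_(absz (k + M%:Z))) p0.
  rewrite coef_poly coef0 ifT; last by lia.
  rewrite /w; have -> : (absz (k + M%:Z))%:Z - M%:Z = k by lia.
  by move/eqP; rewrite subr_eq0 => /eqP.
apply: (@poly_inj_roots _ (fun n => n.+1%:R)) => [m n /eqP|n].
  by rewrite eqr_nat => /eqP[].
set z : C := n.+1%:R; have z0 : z != 0 by rewrite pnatr_eq0.
have := E z z0; rewrite (@leval_widen u M) ?leq_maxl //.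
rewrite (@leval_widen v M) ?leq_maxr //.
move/eqP; rewrite -subr_eq0 -sumrB /srange big_map big_mkord => /eqP H.
rewrite /root horner_poly.
have -> : \sum_(i < M.*2.+1) w i * z ^+ i = z ^ M%:Z *
  \sum_(i < M.*2.+1) (lcoef u (i%:Z - M%:Z) * z ^ (i%:Z - M%:Z)
    - lcoef v (i%:Z - M%:Z) * z ^ (i%:Z - M%:Z)).
  rewrite mulr_sumr; apply: eq_bigr => i _.
  rewrite -mulrBl mulrCA -expfzDr // [M%:Z + _]addrC subrK.
  by rewrite -/(w i).
by rewrite H mulr0.
Qed.

(** Star, symmetry and being a Laurent polynomial are recast for functions away from 0, so that
    later identities are pointwise and need no coefficient computations. On the unit circle [fstar]
    is complex conjugation of values. *)
Definition fstar f (z : C) : C := (f (z^*)^-1)^*.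
Definition symfun f t := forall z : C, z != 0 ->
  f z = (-1) ^+ t.1 * z ^ t.2 * f z^-1.
Definition laurent f := exists u, forall z : C, z != 0 -> leval u z = f z.

Lemma conjc_conjC (z : C) : conjc z = z^*.
Proof. by []. Qed.

Lemma conjCXz (z : C) (k : int) : (z ^ k)^* = (z^*) ^ k.
Proof. by case: k => k; rewrite ?fmorphV rmorphXn. Qed.

Lemma leval_lstar u (z : C) : z != 0 -> leval (lstar u) z = fstar (leval u) z.
Proof.
move=> z0; rewrite /fstar.
rewrite (@leval_uniq _ [seq - k | k <- srange (lsupp u)]).
- rewrite (leval_widen _ (leqnn _)) big_map rmorph_sum /=; apply: eq_bigr => k _.
  rewrite opprK conjc_conjC rmorphM /= conjCXz fmorphV /= conjCK.
  by rewrite exprz_inv.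
- by rewrite map_inj_uniq ?srange_uniq //; exact: oppr_inj.
- move=> k; rewrite -{1}[k]opprK mem_map ?mem_srange -?ltnNge; last exact: oppr_inj.
  by move/lsuppP => /= ->; rewrite conjc_conjC conjC0.
Qed.

Lemma lsym_suppP u t (k : int) : (lsupp u + `|t.2| < `|k|)%N ->
  (-1) ^+ t.1 * lcoef u (t.2 - k) = 0.
Proof. by move=> hk; rewrite lsuppP ?mulr0 //; lia. Qed.

Definition lsym u t := LPoly (@lsym_suppP u t).

Lemma leval_lsym u t (z : C) : z != 0 ->
  leval (lsym u t) z = (-1) ^+ t.1 * z ^ t.2 * leval u z^-1.
Proof.
move=> z0; have inj : injective (fun k : int => t.2 - k) by move=> i j; lia.
rewrite (@leval_uniq _ [seq t.2 - k | k <- srange (lsupp u)]).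
- rewrite (leval_widen _ (leqnn _)) big_map mulr_sumr /=; apply: eq_bigr => k _.
  have -> : t.2 - (t.2 - k) = k by lia.
  by rewrite expfzDr // exprz_inv; ring.
- by rewrite map_inj_uniq ?srange_uniq.
- move=> k; have {1}-> : k = t.2 - (t.2 - k) by lia.
  rewrite (mem_map inj) mem_srange -ltnNge.
  by move/lsuppP => /= ->; rewrite mulr0.
Qed.

(** Symmetry means that [u] and [lsym u t] have the same coefficients, and these are determined by
    values. *)
Lemma lp_has_symP u t : lp_has_sym u t <-> symfun (leval u) t.
Proof.
split=> [su z z0|su m].
  rewrite -leval_lsym //.
  rewrite (@leval_widen u (lsupp u + `|t.2|)) ?leq_addr // (leval_widen _ (leqnn _)).
  by apply: eq_bigr => k _ /=; rewrite {1}su.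
rewrite -[RHS]/(lcoef (lsym u t) m); apply: leval_inj => z z0.
by rewrite leval_lsym // -su.
Qed.

(** * Closure properties of Laurent polynomial functions *)

Lemma lmono_suppP (c : C) (k j : int) :
  (`|k| < `|j|)%N -> (if j == k then c else 0) = 0.
Proof. by case: eqP => // ->; rewrite ltnn. Qed.

Definition lmono c k := LPoly (@lmono_suppP c k).

Lemma laurent_ext f g : (forall z : C, z != 0 -> f z = g z) ->
  laurent f -> laurent g.
Proof. by move=> E [u hu]; exists u => z z0; rewrite hu // E. Qed.

Lemma laurent_mono (c : C) (k : int) : laurent (fun z => c * z ^ k).
Proof.
exists (lmono c k) => z _; rewrite (@leval_uniq _ [:: k]) //.
  by rewrite big_seq1 /= eqxx.
by move=> j; rewrite inE => /negPf /= ->.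
Qed.

Lemma ladd_suppP u v (k : int) : (maxn (lsupp u) (lsupp v) < `|k|)%N ->
  lcoef u k + lcoef v k = 0.
Proof. by rewrite gtn_max => /andP[? ?]; rewrite !lsuppP ?addr0. Qed.

Definition ladd u v := LPoly (@ladd_suppP u v).

Lemma laurentD f g : laurent f -> laurent g -> laurent (fun z => f z + g z).
Proof.
move=> [u hu] [v hv]; exists (ladd u v) => z z0.
rewrite -hu // -hv // (leval_widen _ (leqnn _)) /=.
rewrite (@leval_widen u (maxn (lsupp u) (lsupp v))) ?leq_maxl //.
rewrite (@leval_widen v (maxn (lsupp u) (lsupp v))) ?leq_maxr //.
by rewrite -big_split; apply: eq_bigr => k _ /=; rewrite mulrDl.
Qed.

Lemma laurentC (c : C) : laurent (fun _ => c).
Proof. by apply: laurent_ext (laurent_mono c 0) => z _; rewrite expr0z mulr1. Qed.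

Lemma laurent_sum (I : Type) (r : seq I) (F : I -> C -> C) :
  (forall i, laurent (F i)) -> laurent (fun z => \sum_(i <- r) F i z).
Proof.
move=> hF; elim: r => [|i r IHr].
  by apply: laurent_ext (laurentC 0) => z _; rewrite big_nil.
by apply: laurent_ext (laurentD (hF i) IHr) => z _; rewrite big_cons.
Qed.

(** Expanding into a double sum of monomials avoids convolution of coefficients. *)
Lemma laurentM f g : laurent f -> laurent g -> laurent (fun z => f z * g z).
Proof.
move=> [u hu] [v hv].
pose F k z : C := \sum_(j <- srange (lsupp v)) lcoef u k * lcoef v j * z ^ (k + j).
apply: (@laurent_ext (fun z => \sum_(k <- srange (lsupp u)) F k z)).
  move=> z z0; rewrite -hu // -hv // !(leval_widen _ (leqnn _)) mulr_suml.
  apply: eq_bigr => k _; rewrite mulr_sumr; apply: eq_bigr => j _.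
  by rewrite expfzDr //; ring.
by apply: laurent_sum => k; apply: laurent_sum => j; exact: laurent_mono.
Qed.

Lemma laurent_fstar f : laurent f -> laurent (fstar f).
Proof.
move=> [u hu]; exists (lstar u) => z z0; rewrite leval_lstar // /fstar hu //.
by rewrite invr_eq0 conjC_eq0.
Qed.

Lemma laurent_X : laurent id.
Proof. by apply: laurent_ext (laurent_mono 1 1) => z _; rewrite mul1r expr1z. Qed.

Lemma laurentV : laurent GRing.inv.
Proof. by apply: laurent_ext (laurent_mono 1 (-1)) => z _; rewrite mul1r. Qed.

Lemma laurent_horner (p : {poly C}) f : laurent f -> laurent (fun z => p.[f z]).
Proof.
move=> hf; elim/poly_ind: p => [|p c IHp].
  by apply: laurent_ext (laurentC 0) => z _; rewrite horner0.
apply: laurent_ext (laurentD (laurentM IHp hf) (laurentC c)) => z _.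
by rewrite !hornerE.
Qed.

(** * Symmetric Laurent polynomials and the variable z + 1/z *)

Lemma leval_ext u v (z : C) : lcoef u =1 lcoef v -> leval u z = leval v z.
Proof.
move=> E; rewrite (@leval_widen u (maxn (lsupp u) (lsupp v))) ?leq_maxl //.
rewrite (@leval_widen v (maxn (lsupp u) (lsupp v))) ?leq_maxr //.
by apply: eq_bigr => k _; rewrite E.
Qed.

Lemma symfunD f g t : symfun f t -> symfun g t -> symfun (fun z => f z + g z) t.
Proof. by move=> hf hg z z0; rewrite {1}hf // {1}hg // mulrDr. Qed.

Lemma symfunM f g t t' : symfun f t -> symfun g t' ->
  symfun (fun z => f z * g z) (tmul t t').
Proof.
by move=> hf hg z z0; rewrite {1}hf // {1}hg // signr_addb expfzDr //; ring.
Qed.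

Lemma symfunZ (c : C) f t : symfun f t -> symfun (fun z => c * f z) t.
Proof. by move=> hf z z0; rewrite {1}hf // mulrCA. Qed.

Lemma symfun_star f t : symfun f t -> symfun (fstar f) (tinv t).
Proof.
move=> hf z z0; rewrite /fstar hf ?invr_eq0 ?conjC_eq0 //.
rewrite invrK !rmorphM /= rmorphXn rmorphN rmorph1 conjCXz !fmorphV /= conjCK.
by rewrite invrK exprz_inv.
Qed.

Definition joukowski (z : C) : C := z + z^-1.
Local Notation jk := joukowski.

Lemma jkV (z : C) : jk z^-1 = jk z.
Proof. by rewrite /jk invrK addrC. Qed.

Lemma symfun_jk p : symfun (fun z => p.[jk z]) tone1.
Proof. by move=> z _; rewrite jkV expr0 expr0z !mul1r. Qed.

Lemma laurent_jk p : laurent (fun z : C => p.[jk z]).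
Proof. exact: laurent_horner (laurentD laurent_X laurentV). Qed.

Lemma fstar_jk p (z : C) : fstar (fun z => p.[jk z]) z = (pconj p).[jk z].
Proof.
by rewrite /fstar /jk horner_pconj rmorphD /= fmorphV invrK addrC.
Qed.

Lemma poly_eq_circle p q :
  (forall z : C, `|z| = 1 -> p.[jk z] = q.[jk z]) -> p = q.
Proof.
move=> E; apply/eqP; rewrite -subr_eq0; apply/eqP.
(* A point of the circle with real part [y n] has [x = 2 (y n)], which gives infinitely many values
   of [x]. *)
pose y n : R := n.+1%:R^-1.
apply: (@poly_inj_roots _ (fun n => (y n)%:C%C *+ 2)) => [m n|n].
  rewrite -!(raddfMn (real_complex R)) => -[] /eqP.
  by rewrite eqrMn2r // (inj_eq invr_inj) eqr_nat => /eqP; lia.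
have y1 : y n ^+ 2 <= 1.
  rewrite expr_le1 // ?invr_ge0 ?ler0n // invf_le1 ?ltr0n //.
  by rewrite ler1n.
pose z : C := Complex (y n) (Num.sqrt (1 - y n ^+ 2)).
have z1 : `|z| = 1.
  rewrite normc_def /= sqr_sqrtr ?subr_ge0 //.
  by rewrite addrC subrK sqrtr1.
have zV : z^-1 = z^* by rewrite invC_norm z1 expr1n invr1 mul1r.
have -> : (y n)%:C%C *+ 2 = jk z.
  by rewrite /jk zV; apply/eqP; rewrite eq_complex /= addr0 subrr !eqxx.
by rewrite /root hornerD hornerN E // subrr.
Qed.

(* [z^j + eps z^(c-j)] satisfies [s_(j+1) + s_(j-1) = (z + 1/z) s_j], so two
   consecutive terms determine all of them. *)
Definition symmono t (j : int) (z : C) : C :=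
  z ^ j + (-1) ^+ t.1 * z ^ (t.2 - j).

Lemma symmono_rec t j (z : C) : z != 0 ->
  symmono t (j + 1) z + symmono t (j - 1) z = jk z * symmono t j z.
Proof.
move=> z0; rewrite /symmono /jk.
have -> : t.2 - (j + 1) = t.2 - j - 1 by lia.
have -> : t.2 - (j - 1) = t.2 - j + 1 by lia.
by rewrite !expfzDr // !expr1z -!invr_expz expr1z; ring.
Qed.

Definition jk_multiple g f := exists p, forall z : C, z != 0 -> f z = g z * p.[jk z].

Lemma symmono_multiple g t k :
  jk_multiple g (symmono t k) -> jk_multiple g (symmono t (k + 1)) ->
  forall j, jk_multiple g (symmono t j).
Proof.
move=> h0 h1.
(* The induction runs upwards and downwards from [k] at once, carrying two consecutive indices in
   each direction. *)
suff H (n : nat) : (jk_multiple g (symmono t (k + n%:Z)) /\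
    jk_multiple g (symmono t (k + n%:Z + 1))) /\
    (jk_multiple g (symmono t (k - n%:Z)) /\
     jk_multiple g (symmono t (k - n%:Z + 1))).
  move=> j; case: (lerP k j) => kj.
    by have [[+ _] _] := H (absz (j - k)); congr (jk_multiple _ (symmono _ _)); lia.
  by have [_ [+ _]] := H (absz (j - k)); congr (jk_multiple _ (symmono _ _)); lia.
elim: n => [|n [[[p hp] [q hq]] [[p' hp'] [q' hq']]]].
  by have -> : k + 0%:Z = k by lia; have -> : k - 0%:Z = k by lia.
split; split.
- by exists q => z z0; rewrite -hq //; congr symmono; lia.
- exists ('X * q - p) => z z0; rewrite !hornerE mulrBr mulrCA -hq // -hp //.
  have := symmono_rec t (k + n%:Z + 1) z0; rewrite addrK => <-.
  by rewrite addrK; congr symmono; lia.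
- exists ('X * p' - q') => z z0; rewrite !hornerE mulrBr mulrCA -hq' // -hp' //.
  have := symmono_rec t (k - n%:Z) z0 => <-.
  by rewrite [RHS]addrAC subrr add0r; congr symmono; lia.
- by exists p' => z z0; rewrite -hp' //; congr symmono; lia.
Qed.

Lemma symfun_multiple g t u : (forall j, jk_multiple g (symmono t j)) ->
  symfun (leval u) t -> jk_multiple g (leval u).
Proof.
move=> hg su.
(* Averaging [u] with its symmetric image, which is [u] itself, writes it as a combination of the
   [symmono t k]. *)
have {su} E (z : C) : z != 0 -> leval u z =
    \sum_(k <- srange (lsupp u)) (2^-1 * lcoef u k) * symmono t k z.
  move=> z0.
  have -> : leval u z =
      2^-1 * (leval u z + (-1) ^+ t.1 * z ^ t.2 * leval u z^-1).
    by rewrite -su //; field.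
  rewrite !(leval_widen _ (leqnn _)) [X in _ + X]mulr_sumr -big_split mulr_sumr /=.
  apply: eq_bigr => k _; rewrite /symmono expfzDr // exprz_inv; ring.
suff [p hp] : jk_multiple g (fun z =>
    \sum_(k <- srange (lsupp u)) 2^-1 * lcoef u k * symmono t k z).
  by exists p => z z0; rewrite E // hp.
elim: (srange _) => [|k s [p hp]].
  by exists 0 => z z0; rewrite big_nil horner0 mulr0.
have [q hq] := hg k; exists ((2^-1 * lcoef u k)%:P * q + p) => z z0.
by rewrite big_cons hp // hq // hornerD hornerM hornerC; ring.
Qed.

Lemma int_parity (c : int) : exists k : int, c = k + k \/ c = k + k + 1.
Proof. exists (divz c 2); lia. Qed.

Lemma expz_subr (z : C) (k l : int) : z != 0 -> z ^ (k - l) = z ^ k * (z ^ l)^-1.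
Proof. by move=> z0; rewrite expfzDr // invr_expz. Qed.

(** By parity of the exponent and sign: [z^k (1 + e z)] with norm [2 + e x], [z^k (z - 1/z)] with
    norm [4 - x^2], and [z^k] with norm 1. All have real coefficients, so star is [z -> 1/z].
    Generation is checked on [symmono t k] and [symmono t (k + 1)], which are respectively [g, e g],
    then [0, g], then [2 g, x g]. The final disjunction isolates the one norm that needs
    [hform_linear_value]. *)
Lemma symfun_generator t : exists g N,
  [/\ laurent g, symfun g t, forall z : C, z != 0 -> fstar g z = g z^-1,
   forall z : C, z != 0 -> g z * g z^-1 = N.[jk z] &
   forall u, symfun (leval u) t -> jk_multiple g (leval u)] /\
  ([/\ pconj N = N, N != 0 & (size N <= 2)%N] \/
   N = 4%:P - 'X ^+ 2 /\ exists k : int, t = (true, k + k) /\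
     forall z, g z = z ^ k * (z - z^-1)).
Proof.
case: t => b c; have [k ck] := int_parity c.
have zk0 (z : C) : z != 0 -> z ^ k != 0 by move=> z0; rewrite expfz_neq0.
have X1 (z : C) : z ^ (1 : int) = z by rewrite expr1z.
case: ck => ->; last first.
  pose e : C := (-1) ^+ b; have ee : e * e = 1 by rewrite -expr2 sqrr_sign.
  have ec : e^* = e by rewrite rmorphXn /= rmorphN rmorph1.
  exists (fun z => z ^ k * (1 + e * z)), (2%:P + e%:P * 'X); split; last first.
    left; split.
    - by rewrite rmorphD rmorphM /= !pconjC pconjX ec rmorph_nat.
    - apply/eqP => /(congr1 (fun p : {poly C} => p`_0)) /eqP.
      by rewrite coefD coefMX !coefC /= addr0 pnatr_eq0.
    - by rewrite addrC size_MXaddC; case: ifP => // _; rewrite ltnS size_polyC_leq1.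
  split.
  - apply: laurentM.
      by apply: laurent_ext (laurent_mono 1 k) => z _; rewrite mul1r.
    by apply: laurentD (laurentC 1) (laurentM (laurentC e) laurent_X).
  - move=> z z0 /=; rewrite -/e !expfzDr // X1 exprz_inv -invr_expz.
    have := zk0 z z0; set w := z ^ k => w0.
    transitivity (e * e * w + e * w * z); first by rewrite ee; ring.
    by field; rewrite z0.
  - move=> z z0; rewrite /fstar rmorphM rmorphD rmorph1 rmorphM /= ec.
    by rewrite conjCXz fmorphV /= conjCK.
  - move=> z z0; rewrite hornerD hornerM !hornerC hornerX /jk.
    rewrite exprz_inv -invr_expz; have := zk0 z z0; set w := z ^ k => w0.
    transitivity (1 + e * e + e * (z + z^-1)); last by rewrite ee; ring.
    by field; rewrite z0.
  - move=> u; apply: symfun_multiple; apply: (@symmono_multiple _ _ k).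
      exists 1 => z z0; rewrite hornerC mulr1 /symmono /= -/e.
      have -> : k + k + 1 - k = k + 1 by lia.
      by rewrite expfzDr // X1; ring.
    exists e%:P => z z0; rewrite hornerC /symmono /= -/e.
    have -> : k + k + 1 - (k + 1) = k by lia.
    rewrite expfzDr // X1.
    transitivity (e * e * z ^ k * z + e * z ^ k); last by ring.
    by rewrite ee mul1r.
case: b.
  exists (fun z => z ^ k * (z - z^-1)), (4%:P - 'X ^+ 2); split; last first.
    by right; split=> //; exists k.
  split.
  - apply: laurentM.
      by apply: laurent_ext (laurent_mono 1 k) => z _; rewrite mul1r.
    apply: laurentD laurent_X _.
    by apply: laurent_ext (laurentM (laurentC (-1)) laurentV) => z _; rewrite mulN1r.
  - move=> z z0 /=; rewrite !expfzDr // invrK exprz_inv -invr_expz.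
    by have := zk0 z z0; set w := z ^ k => w0; field; rewrite z0.
  - move=> z z0; rewrite /fstar rmorphM rmorphB /= !fmorphV /= conjCK.
    by rewrite conjCXz fmorphV /= conjCK.
  - move=> z z0; rewrite hornerD hornerN hornerXn hornerC /jk invrK.
    rewrite exprz_inv -invr_expz; have := zk0 z z0; set w := z ^ k => w0.
    by field; rewrite z0.
  - move=> u; apply: symfun_multiple; apply: (@symmono_multiple _ _ k).
      exists 0 => z z0; rewrite horner0 mulr0 /symmono /=.
      by rewrite addrK expr1 mulN1r subrr.
    exists 1 => z z0; rewrite hornerC mulr1 /symmono /=.
    have -> : k + k - (k + 1) = k - 1 by lia.
    by rewrite expr1 mulN1r expfzDr // expz_subr // X1 mulrBr.
exists (fun z => z ^ k), 1; split; last first.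
  by left; rewrite rmorph1 oner_neq0 size_poly1.
split.
- by apply: laurent_ext (laurent_mono 1 k) => z _; rewrite mul1r.
- move=> z z0 /=; rewrite !expfzDr // exprz_inv -invr_expz expr0.
  by have := zk0 z z0; set w := z ^ k => w0; field.
- by move=> z z0; rewrite /fstar conjCXz fmorphV /= conjCK.
- by move=> z z0; rewrite exprz_inv -invr_expz hornerC divff ?zk0.
- move=> u; apply: symfun_multiple; apply: (@symmono_multiple _ _ k).
    exists 2%:P => z z0; rewrite hornerC /symmono /= addrK; ring.
  exists 'X => z z0; rewrite hornerX /symmono /= /jk.
  have -> : k + k - (k + 1) = k - 1 by lia.
  by rewrite expr0 mul1r expfzDr // expz_subr // X1 mulrDr.
Qed.

Lemma symfun_tone1 u : symfun (leval u) tone1 ->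
  exists p, forall z : C, z != 0 -> leval u z = p.[jk z].
Proof.
move=> su; suff [p hp] : jk_multiple (fun _ => 1) (leval u).
  by exists p => z z0; rewrite hp // mul1r.
apply: symfun_multiple su; apply: (@symmono_multiple _ _ 0).
  by exists 2%:P => z z0; rewrite hornerC /symmono /= subr0 expr0z; ring.
by exists 'X => z z0; rewrite hornerX /symmono /= !add0r expr1z expr0 !mul1r.
Qed.

End LaurentFunctions.

(** * Factorization *)

Lemma ord2P (i : 'I_2) : i = 0 \/ i = 1.
Proof. by case: i => [[|[|//]]] hi; [left | right]; apply: val_inj. Qed.

Lemma det_mx22 (K : comNzRingType) (M : 'M[K]_2) :
  \det M = M 0 0 * M 1 1 - M 0 1 * M 1 0.
Proof.
rewrite (expand_det_row M 0) !big_ord_recl big_ord0 addr0 /cofactor !det_mx11 !mxE.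
rewrite /= /bump /= !(addn0, add0n, expr0, expr1, mul1r, mulN1r, mulrN).
by congr (_ * M _ _ - M _ _ * M _ _); apply: val_inj.
Qed.

Section Factorization.
Variable R : realType.
Local Notation C := R[i].
Local Notation jk := (@joukowski R).
Implicit Types (f g : C -> C) (t s : symtype) (p q : {poly C}).

Lemma fstarM f g (z : C) : fstar (fun z => f z * g z) z = fstar f z * fstar g z.
Proof. by rewrite /fstar rmorphM. Qed.

Lemma fstarD f g (z : C) : fstar (fun z => f z + g z) z = fstar f z + fstar g z.
Proof. by rewrite /fstar rmorphD. Qed.

Lemma fstarK f (z : C) : fstar (fstar f) z = f z.
Proof. by rewrite /fstar fmorphV /= !conjCK invrK. Qed.

Lemma eq_fstar f g (z : C) : (forall z : C, z != 0 -> f z = g z) -> z != 0 ->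
  fstar f z = fstar g z.
Proof. by move=> E z0; rewrite /fstar E // invr_eq0 conjC_eq0. Qed.

(** This is [v A v^star] for the row vector [v = (v1, v2)] and [A] with rows [a, b] and
    [b^star, d]. *)
Definition cform (a b d v1 v2 : C -> C) (z : C) : C :=
  v1 z * fstar v1 z * a z + v1 z * fstar v2 z * b z +
  v2 z * fstar v1 z * fstar b z + v2 z * fstar v2 z * d z.

(** On vectors [(p(x), g r(x))] the factors [g g^star] become [N], so the values are those of the
    polynomial form with entries [a], [N b], [N d], whose determinant is [c N]. *)
Lemma constant_value t (a b d : {poly C}) g N (c : R) :
  laurent g -> symfun g t -> (forall z : C, z != 0 -> fstar g z = g z^-1) ->
  (forall z : C, z != 0 -> g z * g z^-1 = N.[jk z]) ->
  ([/\ pconj N = N, N != 0 & (size N <= 2)%N] \/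
   N = 4%:P - 'X ^+ 2 /\ exists k : int, t = (true, k + k) /\
     forall z, g z = z ^ k * (z - z^-1)) ->
  pconj a = a -> pconj d = d -> c < 0 ->
  a * d - N * b * pconj b = (c%:C%C)%:P ->
  exists v1 v2 s (l : C),
  [/\ laurent v1, laurent v2, symfun v1 s & symfun v2 (tmul s t)] /\
  [/\ l != 0, l^* = l & forall z : C, z != 0 ->
      cform (fun z => a.[jk z]) (fun z => g z * b.[jk z]) (fun z => d.[jk z])
        v1 v2 z = l].
Proof.
move=> lg sg gstar gN hN ra rd c0 det.
have rN : pconj N = N.
  by case: hN => [[]//|[-> _]]; rewrite rmorphB rmorphXn /= pconjC pconjX rmorph_nat.
have cC0 : c%:C%C != 0 :> C by rewrite (fmorph_eq0 (real_complex R)) lt_eqF.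
have DE : a * (N * d) - N * b * pconj (N * b) = (c%:C%C)%:P * N.
  by rewrite -det rmorphM /= rN; ring.
have rNd : pconj (N * d) = N * d by rewrite rmorphM /= rN rd.
have finish v (l : C) : l != 0 -> l^* = l -> hform a (N * b) (N * d) v v = l%:P ->
  exists v1 v2 s (l : C),
  [/\ laurent v1, laurent v2, symfun v1 s & symfun v2 (tmul s t)] /\
  [/\ l != 0, l^* = l & forall z : C, z != 0 ->
      cform (fun z => a.[jk z]) (fun z => g z * b.[jk z]) (fun z => d.[jk z])
        v1 v2 z = l].
  move=> l0 lr Bv.
  exists (fun z => v.1.[jk z]), (fun z => g z * v.2.[jk z]), tone1, l.
  split; split=> //.
  - exact: laurent_jk.
  - by apply: laurentM => //; apply: laurent_jk.
  - exact: symfun_jk.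
  - have -> : tmul tone1 t = tmul t tone1.
      by rewrite /tmul /= addbF add0r addr0.
    by apply: symfunM => //; exact: symfun_jk.
  move=> z z0; rewrite -[RHS](hornerC l (jk z)) -Bv /hform /cform.
  rewrite !fstarM !fstar_jk gstar // rmorphM /= rN !hornerD !hornerM -gN //.
  ring.
case: hN => [[_ N0 sN]|[NE [k [tE gE]]]].
  have [||v [l [l0 lr Bv]]] := @hform_const_value _ a (N * b) (N * d) ra rNd.
  - by rewrite DE mulf_neq0 // polyC_eq0.
  - by rewrite DE mul_polyC (leq_trans (size_scale_leq _ _)).
  exact: finish Bv.
have N2 : root N (- 2).
  by rewrite NE /root hornerD hornerN hornerXn hornerC; apply/eqP; ring.
have sX : size (- 'X^2 : {poly C}) = 3 by rewrite size_polyN size_polyXn.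
have s4 : (size (4%:P : {poly C}) < size (- 'X^2 : {poly C}))%N.
  by rewrite sX (leq_ltn_trans (size_polyC_leq1 _)).
have sN : size N = 3 by rewrite NE addrC size_polyDl.
have lN : lead_coef N = -1.
  by rewrite NE addrC lead_coefDl // lead_coefN lead_coefXn.
have [||||v [l [l0 lr [Bv|[Bv rv]]]]] :=
  @hform_linear_value _ a (N * b) (N * d) ra rNd.
- by rewrite DE mul_polyC size_scale.
(* The sign of [c] enters here: [4 - x^2] has leading coefficient -1, so that of [c N] is
   [- c > 0]. *)
- rewrite DE mul_polyC lead_coefZ lN mulrN1 oppr_gt0.
  by rewrite -[0]/(0%:C%C) ltcR.
- by rewrite rootM N2.
- by rewrite rootM N2.
- exact: finish Bv.
(* Dividing [v] by [1 + z] removes the factor [x + 2 = (1 + z) (1 + 1/z)]. *)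
have [q vq] := factor_theorem _ _ rv.
have {}vq : v.1 = q * ('X + 2%:P) by rewrite vq polyCN opprK.
have X2 : 'X + 2%:P != 0 :> {poly C} by rewrite -size_poly_eq0 size_XaddC.
have pX2 : pconj ('X + 2%:P) = 'X + 2%:P :> {poly C}.
  by rewrite -[LHS]/(pconj ('X + _)) rmorphD /= pconjX pconjC rmorph_nat.
set r := v.2.
(* This is [B v v = l (x + 2)] with one factor [x + 2] cancelled, by [N = (2 - x) (x + 2)]. *)
have E : ('X + 2%:P) * q * pconj q * a +
    N * (q * pconj r * b + r * pconj q * pconj b)
   + (2%:P - 'X) * (r * pconj r * d) = l%:P.
  apply: (mulIf X2); rewrite -Bv /hform vq -/r !rmorphM /= rN pX2 NE.
  have -> : 4%:P - 'X^2 = (2%:P - 'X) * ('X + 2%:P) :> {poly C}.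
    by rewrite -[4]/((2 * 2)%:R) natrM polyCM; ring.
  ring.
(* Since [z - 1/z = (1 + z) (1 - 1/z)], both entries are exact quotients by [1 + z]; their types
   become [z^-1] and [- z^(2k-1)], whose ratio is still [t]. *)
exists (fun z => (1 + z^-1) * q.[jk z]), (fun z => z ^ k * (1 - z^-1) * r.[jk z]).
exists (false, -1), l; split; split=> //.
- apply: laurentM (laurent_jk _).
  by apply: laurentD (laurentC 1) (@laurentV R).
- apply: laurentM (laurent_jk _); apply: laurentM.
    by apply: laurent_ext (laurent_mono 1 k) => z _; rewrite mul1r.
  apply: laurentD (laurentC 1) _.
  by apply: laurent_ext (laurentM (laurentC (-1)) (@laurentV R)) => z _;
    rewrite mulN1r.
- move=> z z0 /=; rewrite jkV invrK expr0 mul1r -invr_expz expr1z.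
  by field.
- move=> z z0; rewrite tE /= jkV invrK expr1 !expfzDr // -!invr_expz expr1z.
  rewrite exprz_inv -invr_expz.
  have : z ^ k != 0 by rewrite expfz_neq0.
  by set w := z ^ k => w0; field; rewrite ?w0 z0.
move=> z z0; rewrite /cform !fstarM !fstar_jk gstar // !gE.
have := congr1 (fun p : {poly C} => p.[jk z]) E.
rewrite hornerC => <-; rewrite !(hornerD, hornerM, hornerN, hornerC, hornerX) NE.
rewrite hornerD hornerN hornerXn hornerC.
have -> : fstar (fun z : C => 1 + z^-1) z = 1 + z.
  by rewrite /fstar rmorphD rmorph1 /= invrK conjCK.
have -> : fstar (fun z : C => 1 - z^-1) z = 1 - z.
  by rewrite /fstar rmorphB rmorph1 /= invrK conjCK.
have -> : fstar (fun z : C => z ^ k) z = (z ^ k)^-1.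
  by rewrite /fstar conjCXz fmorphV /= conjCK exprz_inv invr_expz.
rewrite invrK exprz_inv -invr_expz /joukowski.
have : z ^ k != 0 by rewrite expfz_neq0.
by set w := z ^ k => w0; field; rewrite ?w0 z0.
Qed.

(** * From a vector of constant value to the matrix [U] *)

Lemma mxeval_UJUstar (U : 'M[lpoly R]_2) (z : C) i j : z != 0 ->
  (mxeval U z *m J2 R *m mxeval (mxstar U) z) i j =
  leval (U i 0) z * fstar (leval (U j 0)) z -
  leval (U i 1) z * fstar (leval (U j 1)) z.
Proof.
move=> z0; rewrite !mxE !big_ord_recl big_ord0 !mxE !big_ord_recl !big_ord0 !mxE.
rewrite !leval_lstar //= !(mulr0, mulr1, addr0, add0r, mulrN1, mulNr).
by congr (_ * fstar (leval (U j _)) z - leval (U i _) z * fstar (leval (U j _)) z);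
  apply: val_inj.
Qed.

Lemma laurent_mx (f : 'I_2 -> 'I_2 -> C -> C) :
  (forall i j, laurent (f i j)) ->
  exists U : 'M[lpoly R]_2, forall i j (z : C), z != 0 -> leval (U i j) z = f i j z.
Proof.
move=> lf; have [|F hF] := @fin_all_exists _ _ (fun i (w : 'I_2 -> lpoly R) =>
  forall j (z : C), z != 0 -> leval (w j) z = f i j z).
  by move=> i; apply: fin_all_exists (lf i).
by exists (\matrix_(i, j) F i j) => i j z z0; rewrite mxE hF.
Qed.

Lemma symfun_factor (A : 'M[lpoly R]_2) (f : 'I_2 -> 'I_2 -> C -> C)
    (tau rho : 'I_2 -> symtype) :
  (forall i j, laurent (f i j)) ->
  (forall i j, symfun (f i j) (tmul (tinv (tau i)) (rho j))) ->
  (forall i j (z : C), z != 0 -> leval (A i j) z =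
     f i 0 z * fstar (f j 0) z - f i 1 z * fstar (f j 1) z) ->
  exists2 U, compat_sym_with U tau rho & forall z : C, z != 0 ->
    mxeval A z = mxeval U z *m J2 R *m mxeval (mxstar U) z.
Proof.
move=> lf sf E; have [U hU] := laurent_mx lf; exists U.
  move=> i j; apply/lp_has_symP => z z0; rewrite !hU ?invr_eq0 //.
  exact: sf.
move=> z z0; apply/matrixP => i j; rewrite mxeval_UJUstar // mxE E // !hU //.
by congr (_ * _ - _ * _); apply: eq_fstar => // w w0; rewrite hU.
Qed.

Lemma tmulVK t s : tmul (tinv t) (tmul s t) = s.
Proof.
case: t s => [b c] [b' c']; rewrite /tmul /tinv /=; congr (_, _); last by ring.
by case: b b' => [] [].
Qed.

Lemma tmul1t t : tmul (tinv tone1) t = t.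
Proof. by case: t => b c; rewrite /tmul /= oppr0 add0r. Qed.

Lemma tinvM t s : tmul (tinv t) (tinv s) = tinv (tmul s t).
Proof. by rewrite /tmul /tinv /= addbC -opprD addrC. Qed.

Lemma tmulV_ratio t s : tmul (tinv (tmul (tinv t) s)) (tmul (tinv tone1) s) = t.
Proof.
case: t s => [b c] [b' c']; rewrite /tmul /tinv /=; congr (_, _); last by ring.
by case: b b' => [] [].
Qed.

(** With [y = v A], the matrix [A - y^star y / l] is Hermitian and killed by [v], hence a multiple
    of the rank one matrix built from [n = (- v2, v1)]; the factor is [c / l]. As [c < 0], the two
    rank one terms have opposite signs. *)
Lemma factor_of_constant_value (A : 'M[lpoly R]_2) t (c : R) v1 v2 s (l : C) :
  let a := leval (A 0 0) in let b := leval (A 0 1) in let d := leval (A 1 1) in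
  (forall z : C, z != 0 -> fstar a z = a z) ->
  (forall z : C, z != 0 -> fstar d z = d z) ->
  (forall z : C, z != 0 -> leval (A 1 0) z = fstar b z) ->
  (forall z : C, z != 0 -> a z * d z - b z * fstar b z = c%:C%C) ->
  symfun a tone1 -> symfun b t -> symfun d tone1 -> c < 0 ->
  laurent v1 -> laurent v2 -> symfun v1 s -> symfun v2 (tmul s t) ->
  l != 0 -> l^* = l -> (forall z : C, z != 0 -> cform a b d v1 v2 z = l) ->
  exists U tau rho, [/\ compat_sym_with U tau rho,
    forall z : C, z != 0 ->
      mxeval A z = mxeval U z *m J2 R *m mxeval (mxstar U) z,
    tau 0 = tone1 & tau 1 = t].
Proof.
move=> a b d ra rd A10 det sa sb sd c0 lv1 lv2 sv1 sv2 l0 lr cf.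
have la : laurent a by exists (A 0 0).
have lb : laurent b by exists (A 0 1).
have ld : laurent d by exists (A 1 1).
have lb' := laurent_fstar lb.
pose y1 z := v1 z * a z + v2 z * fstar b z.
pose y2 z := v1 z * b z + v2 z * d z.
pose y (i : 'I_2) := if i == 0 then y1 else y2.
pose n (i : 'I_2) : C -> C := if i == 0 then (fun z => -1 * v2 z) else v1.
pose tau (i : 'I_2) := if i == 0 then tone1 else t.
have ly i : laurent (y i).
  by rewrite /y; case: ifP => _; apply: laurentD; apply: laurentM.
have ln i : laurent (n i).
  by rewrite /n; case: ifP => _ //; apply: laurentM => //; apply: laurentC.
(* The entries of [y] have types [s] and [s t], so the column [y^star] and the column [n] share the
   row types [tau = (1, t)]. *)
have sy i : symfun (fstar (y i)) (tmul (tinv (tau i)) (tinv s)).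
  rewrite /y /tau; case: ifP => _.
    rewrite tmul1t; apply: symfun_star; apply: symfunD.
      have := symfunM sv1 sa; congr symfun; rewrite /tmul /= addbF addr0.
      by case: (s).
    have := symfunM sv2 (symfun_star sb); congr symfun.
    by case: (t) (s) => [x c1] [x' c2]; rewrite /tmul /= addrK -addbA addbb addbF.
  rewrite tinvM; apply: symfun_star; apply: symfunD; first exact: symfunM.
  have := symfunM sv2 sd; congr symfun.
  by case: (t) (s) => [x c1] [x' c2]; rewrite /tmul /= addbF addr0.
have sn i : symfun (n i) (tmul (tinv (tau i)) (tmul s t)).
  rewrite /n /tau; case: ifP => _; first by rewrite tmul1t; apply: symfunZ.
  by rewrite tmulVK.
have key i j (z : C) : z != 0 -> l * leval (A i j) z =
    fstar (y i) z * y j z + c%:C%C * (n i z * fstar (n j) z).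
  move=> z0; rewrite -(det z z0) -(cf z z0) /cform.
  have Ey1 : fstar y1 z = fstar v1 z * a z + fstar v2 z * b z.
    by rewrite fstarD !fstarM fstarK ra.
  have Ey2 : fstar y2 z = fstar v1 z * fstar b z + fstar v2 z * d z.
    by rewrite fstarD !fstarM rd.
  have En : fstar (fun z => -1 * v2 z) z = - fstar v2 z.
    by rewrite fstarM /fstar rmorphN rmorph1 mulN1r.
  case: (ord2P i) => ->; case: (ord2P j) => ->;
    rewrite /y /n /= ?Ey1 ?Ey2 ?En ?A10 // /y1 /y2;
    rewrite -?/a -?/b -?/d; ring.
have cl0 : (c%:C%C : C) != 0 by rewrite (fmorph_eq0 (real_complex R)) lt_eqF.
have cneg : (c%:C%C : C) < 0 by rewrite -[0]/(0%:C%C) ltcR.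
have lreal : l \is Num.real by apply/CrealP.
have fZ (m : C) f (z : C) : m^* = m -> fstar (fun z => m * f z) z = m * fstar f z.
  by move=> mr; rewrite fstarM /fstar mr.
have sqrtR (w : C) : 0 <= w -> (sqrtC w)^* = sqrtC w.
  by move=> w0; apply/CrealP/ger0_real; rewrite sqrtC_ge0.
suff [f [rho [lf sf E]]] : exists (f : 'I_2 -> 'I_2 -> C -> C) rho,
    [/\ forall i j, laurent (f i j),
     forall i j, symfun (f i j) (tmul (tinv (tau i)) (rho j)) &
     forall i j (z : C), z != 0 -> leval (A i j) z =
       f i 0 z * fstar (f j 0) z - f i 1 z * fstar (f j 1) z].
  by have [U cU EU] := symfun_factor lf sf E; exists U, tau, rho.
(* The sign of [l] decides which column comes first, to match [diag(1, -1)]; the scalars [m], [m']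
   are square roots of positive numbers, hence real and fixed by star. *)
case: (real_ltgtP (real0 _) lreal) => [lp|lneg|l00]; last by rewrite l00 eqxx in l0.
  pose m := sqrtC (l^-1); pose m' := sqrtC (- c%:C%C / l).
  have mr : m^* = m by apply: sqrtR; rewrite invr_ge0 ltW.
  have mr' : m'^* = m' by apply: sqrtR; rewrite divr_ge0 ?oppr_ge0 ?ltW.
  have mm : m * m = l^-1 by rewrite -expr2 sqrtCK.
  have mm' : m' * m' = - c%:C%C / l by rewrite -expr2 sqrtCK.
  exists (fun i j => if j == 0 then (fun z => m * fstar (y i) z)
    else (fun z => m' * n i z)).
  exists (fun j => if j == 0 then tinv s else tmul s t); split=> [i j|i j|i j z z0].
  - by case: ifP => _; apply: laurentM (laurentC _) _ => //; apply: laurent_fstar.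
  - by case: ifP => _; apply: symfunZ.
  rewrite /= !fZ // fstarK mulrACA mm [X in _ - X]mulrACA mm'.
  by apply: (mulfI l0); rewrite key //; field.
pose m := sqrtC (- l^-1); pose m' := sqrtC (c%:C%C / l).
have mr : m^* = m by apply: sqrtR; rewrite oppr_ge0 invr_le0 ltW.
have mr' : m'^* = m'.
  by apply: sqrtR; rewrite -mulrNN mulr_ge0 // oppr_ge0 ?invr_le0 ltW.
have mm : m * m = - l^-1 by rewrite -expr2 sqrtCK.
have mm' : m' * m' = c%:C%C / l by rewrite -expr2 sqrtCK.
exists (fun i j => if j == 0 then (fun z => m' * n i z)
    else (fun z => m * fstar (y i) z)).
exists (fun j => if j == 0 then tmul s t else tinv s); split=> [i j|i j|i j z z0].
- by case: ifP => _; apply: laurentM (laurentC _) _ => //; apply: laurent_fstar.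
- by case: ifP => _; apply: symfunZ.
rewrite /= !fZ // fstarK mulrACA mm' [X in _ - X]mulrACA mm.
by apply: (mulfI l0); rewrite key //; field.
Qed.

End Factorization.

Theorem theorem3p4 (R : realType) (A : 'M[lpoly R]_2) (alpha : symtype) (Cst : R) :
  lp_hermitian A ->
  compat_sym A ->
  lp_has_sym (A 0 0) tone1 -> lp_has_sym (A 0 1) alpha ->
  lp_has_sym (A 1 0) (tstar alpha) -> lp_has_sym (A 1 1) tone1 ->
  Cst < 0 ->
  (forall z : R[i], `|z| = 1 -> \det (mxeval A z) = Cst%:C%C) ->
  exists (U : 'M[lpoly R]_2) (tau rho : 'I_2 -> symtype),
    compat_sym_with U tau rho /\
    (forall z : R[i], z != 0 ->
       mxeval A z = mxeval U z *m J2 R *m mxeval (mxstar U) z) /\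
    (* S U_{1,1} / S U_{2,1} = S U_{1,2} / S U_{2,2} = alpha; with
       S U_{j,k} = tau_j^{-1} rho_k, both ratios equal tau_2 tau_1^{-1} *)
    tmul (tinv (tmul (tinv (tau 1)) (rho 0))) (tmul (tinv (tau 0)) (rho 0)) = alpha /\
    tmul (tinv (tmul (tinv (tau 1)) (rho 1))) (tmul (tinv (tau 0)) (rho 1)) = alpha.
Proof.
move=> hA _ /lp_has_symP sa /lp_has_symP sb _ /lp_has_symP sd c0 det.
have star i j (z : R[i]) : z != 0 -> leval (A i j) z = fstar (leval (A j i)) z.
  by move=> z0; rewrite -leval_lstar //; apply: leval_ext => k; rewrite -hA mxE.
have [g [N [[lg sg gs gN dec] hN]]] := @symfun_generator R alpha.
have [a aE] := symfun_tone1 sa; have [d dE] := symfun_tone1 sd.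
have [b bE] := dec _ sb.
have circle0 (z : R[i]) : `|z| = 1 -> z != 0.
  by move=> z1; rewrite -normr_eq0 z1 oner_eq0.
(* A Hermitian diagonal entry equals its star, so its polynomial in [x] has real coefficients. *)
have real i p : (forall z : R[i], z != 0 -> leval (A i i) z = p.[joukowski z]) ->
    pconj p = p.
  move=> E; apply: poly_eq_circle => z /circle0 z0.
  by rewrite -fstar_jk -E // star //; apply: eq_fstar => // w w0; rewrite E.
have ra := real _ _ aE; have rd := real _ _ dE.
have bsE (z : R[i]) : z != 0 ->
    fstar (leval (A 0 1)) z = g z^-1 * (pconj b).[joukowski z].
  by move=> z0; rewrite (eq_fstar bE) // fstarM gs // fstar_jk.
(* The determinant is given on the circle only; being a polynomial in [x], it is then constant at
   every nonzero [z]. *)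
have detE : a * d - N * b * pconj b = (Cst%:C%C)%:P.
  apply: poly_eq_circle => z z1; have z0 := circle0 z z1.
  rewrite hornerC -(det z z1) det_mx22 !mxE (star 1 0) // bsE // aE // dE // bE //.
  by rewrite hornerD hornerN !hornerM -gN //; ring.
have [v1 [v2 [s [l [[lv1 lv2 sv1 sv2] [l0 lr cf]]]]]] :=
  constant_value lg sg gs gN hN ra rd c0 detE.
have [z z0|z z0|z z0|z z0|z z0|U [tau [rho [cU EU t0 t1]]]] :=
  @factor_of_constant_value R A alpha Cst v1 v2 s l
    _ _ _ _ sa sb sd c0 lv1 lv2 sv1 sv2 l0 lr.
- by rewrite -star.
- by rewrite -star.
- by rewrite star.
- rewrite bsE // aE // dE // bE // -[RHS](hornerC _ (joukowski z)) -detE.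
  by rewrite hornerD hornerN !hornerM -gN //; ring.
- by rewrite -(cf z z0) /cform aE // dE // bE // (eq_fstar bE).
by exists U, tau, rho; rewrite t0 t1 !tmulV_ratio.
Qed.
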